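(* Let $(O_1,\dots,O_n)$ be drawn from a distribution $\nu_n$, with each $O_i=(X_i,A_i,Y_i)$ taking values in $\mathcal O=\mathcal X\times\mathcal A\times\mathcal Y$, $\mathcal A\subset[-1,1]$ (the observations need not be independent or identically distributed). Let $P$ be a distribution with support on $\mathcal O$ and let $\|\cdot\|$ be the $L^2(P)$ norm. Let $\Pi$ be a class of maps from $\mathcal X$ to $\mathcal A$, with $L^2(P)$ closure $\overline\Pi$, and let $\mathcal V:\overline\Pi\to\mathbb R$ be a real-valued function (the value). Let $\mathcal V^\star=\sup_{\pi\in\Pi}\mathcal V(\pi)$ and $\mathcal R(\pi)=\mathcal V^\star-\mathcal V(\pi)$. Suppose that there exist a constant $M$, a class $\{f_\pi:\pi\in\overline\Pi\}\subset L^2(P)$ of maps from $\mathcal O$ to $[-M,M]$, an estimator $\{\widehat{\mathcal V}(\pi):\pi\in\Pi\}$ of $\{\mathcal V(\pi):\pi\in\Pi\}$, a (possibly stochastic) rate $r_n\to+\infty$, and stochastic processes $\widetilde{\mathbb G}_n\in\ell^\infty(\mathcal F)$, where $\mathcal F=\{f_\pi:\pi\in\Pi\}$, such that: 1. $\Pi$ is totally bounded with respect to $\|\cdot\|$; 2. $\mathcal V(\cdot)$ is uniformly continuous on $\overline\Pi$ with respect to $\|\cdot\|$; 3. $\pi\mapsto f_\pi$ is uniformly continuous from $\overline\Pi$ to $L^2(P)$, both equipped with $\|\cdot\|$; 4. $\sup_{\pi\in\Pi}\left|r_n\bigl(\widehat{\mathcal V}(\pi)-\mathcal V(\pi)\bigr)-\widetilde{\mathbb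 G}_nf_\pi\right|=o_P(1)$; 5. $\widetilde{\mathbb G}_n\leadsto\widetilde{\mathbb G}_P$ in $\ell^\infty(\mathcal F)$, where almost all sample paths of $\widetilde{\mathbb G}_P$ are uniformly continuous on $\mathcal F$ with respect to $\|\cdot\|$; 6. $\widehat\pi\in\Pi$ is a data-dependent policy with $\widehat{\mathcal V}(\widehat\pi)\ge\sup_{\pi\in\Pi}\widehat{\mathcal V}(\pi)-o_P(r_n^{-1})$. Then $\mathcal R(\widehat\pi)=o_P(r_n^{-1})$.
   Context: $\ell^\infty(\mathcal F)$ is the space of bounded functions $z:\mathcal F\to\mathbb R$ with the supremum norm, and $\leadsto$ denotes weak convergence (convergence in distribution) in that space. The $o_P$ statements are as $n\to\infty$ under the law $\nu_n$ of the data. Measurability issues are disregarded. *)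

(* Defs.v *)
From HB Require Import structures.
From mathcomp Require Import all_boot all_order all_algebra.
From mathcomp Require Import all_classical all_reals all_analysis.

Set Implicit Arguments.
Unset Strict Implicit.
Unset Printing Implicit Defensive.

Import Order.TTheory GRing.Theory Num.Theory.
Import numFieldNormedType.Exports.

Local Open Scope classical_set_scope.
Local Open Scope ring_scope.

(** * The normed space of bounded functions [T -> R] *)

Section linfty.
Context (T : Type) (R : realType).

Definition bounded_pred : {pred T -> R} :=
  mem [set z : T -> R | exists M, forall t, `|z t| <= M].

Record linfty := Linfty {
  linfty_fun :> T -> R ;
  linfty_bounded : linfty_fun \in bounded_pred }.

HB.instance Definition _ := [isSub for linfty_fun].
HB.instance Definition _ := [Choice of linfty by <:].

Lemma bounded_predP (z : T -> R) :
  z \in bounded_pred <-> exists M, forall t, `|z t| <= M.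
Proof. by split=> [/set_mem|/mem_set]. Qed.

Lemma bounded_submod_closed : submod_closed (bounded_pred : {pred T -> R^o}).
Proof.
split=> [|a z1 z2 /bounded_predP[M1 h1] /bounded_predP[M2 h2]].
  by apply/bounded_predP; exists 0 => t; rewrite normr0.
apply/bounded_predP; exists (`|a| * M1 + M2) => t.
rewrite (le_trans (ler_normD _ _))// lerD//.
by rewrite [`|_|](normrM a (z1 t)) ler_wpM2l.
Qed.

HB.instance Definition _ :=
  GRing.isSubmodClosed.Build R (T -> R^o) bounded_pred bounded_submod_closed.
HB.instance Definition _ := [SubChoice_isSubLmodule of linfty by <:].

Definition linfty_norm (z : linfty) : R := sup [set `|z t| | t in [set: T]].

Lemma linfty_has_ubound (z : linfty) :
  has_ubound [set `|z t| | t in [set: T]].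
Proof.
have /bounded_predP[M zM] := linfty_bounded z.
by exists M => _ [t _ <-].
Qed.

Lemma le_linfty_norm (z : linfty) t : `|z t| <= linfty_norm z.
Proof. by apply: ub_le_sup; [exact: linfty_has_ubound|exists t]. Qed.

Lemma linfty_norm_le (z : linfty) (c : R) :
  0 <= c -> (forall t, `|z t| <= c) -> linfty_norm z <= c.
Proof.
move=> c0 zc; rewrite /linfty_norm.
have [->|/set0P ne] := eqVneq [set `|z t| | t in [set: T]] set0.
  by rewrite sup0.
by apply: ge_sup => // _ [t _ <-].
Qed.

Lemma linfty_norm_ge0 (z : linfty) : 0 <= linfty_norm z.
Proof.
rewrite /linfty_norm.
have [->|/set0P[_ [t _ _]]] := eqVneq [set `|z t| | t in [set: T]] set0.
  by rewrite sup0.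
exact: le_trans (le_linfty_norm z t).
Qed.

Lemma linfty_normD (z1 z2 : linfty) :
  linfty_norm (z1 + z2) <= linfty_norm z1 + linfty_norm z2.
Proof.
apply: linfty_norm_le => [|t]; first by rewrite addr_ge0 ?linfty_norm_ge0.
by rewrite (le_trans (ler_normD (z1 t) (z2 t)))// lerD ?le_linfty_norm.
Qed.

Lemma linfty_normZ (l : R) (z : linfty) :
  linfty_norm (l *: z) = `|l| * linfty_norm z.
Proof.
apply/eqP; rewrite eq_le; apply/andP; split.
  apply: linfty_norm_le => [|t]; first by rewrite mulr_ge0 ?linfty_norm_ge0.
  by rewrite [`|_|](normrM l (z t)) ler_wpM2l ?le_linfty_norm.
have [->|l0] := eqVneq l 0; first by rewrite normr0 mul0r linfty_norm_ge0.
rewrite -ler_pdivlMl ?normr_gt0//; apply: linfty_norm_le => [|t].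
  by rewrite mulr_ge0 ?invr_ge0 ?linfty_norm_ge0.
rewrite ler_pdivlMl ?normr_gt0// -normrM.
exact: (le_linfty_norm (l *: z) t).
Qed.

Lemma linfty_norm0_eq0 (z : linfty) : linfty_norm z = 0 -> z = 0.
Proof.
move=> z0; apply/val_inj/funext => t /=.
by apply/eqP; rewrite -normr_le0 -z0 le_linfty_norm.
Qed.

HB.instance Definition _ := Lmodule_isNormed.Build R linfty
  linfty_normD linfty_normZ linfty_norm0_eq0.

End linfty.

(** * Stochastic convergence without measurability assumptions

    [mu_ext P] is the outer probability [P^*]. *)

Section stochastic_convergence.
Context (R : realType) (d : nat -> measure_display).
Context (Omega : forall n, measurableType (d n)).
Context (Pr : forall n, probability (Omega n) R).

(* [Z_n = o_P(a_n)]: [|Z_n| <= eps |a_n|] with (inner) probability tending to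
   one, for each [eps > 0]. [Z_n] may be extended-real-valued because it will be
   a supremum over an infinite class. For [a_n = r_n^-1], the convention
   [0^-1 = 0] is immaterial once [r_n] tends to [+oo] in probability. *)
Definition is_oP (Z : forall n, Omega n -> \bar R)
    (a : forall n, Omega n -> R) : Prop :=
  forall eps : R, 0 < eps ->
    mu_ext (Pr n) [set w | ((eps * `|a n w|)%:E < `|Z n w|)%E]
      @[n --> \oo] --> 0%E.

Definition diverges_in_probability (r : forall n, Omega n -> R) : Prop :=
  forall K : R, mu_ext (Pr n) [set w | r n w <= K] @[n --> \oo] --> 0%E.

End stochastic_convergence.

(* Outer expectation of a bounded function. *)
Definition outer_expectation (R : realType) d (Omega : measurableType d)
    (P : probability Omega R) (Z : Omega -> R) : \bar R :=
  ereal_inf [set (\int[P]_w U w)%E | U in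
    [set U : Omega -> \bar R | P.-integrable [set: Omega] U /\
                               forall w, ((Z w)%:E <= U w)%E]].

(* Weak convergence in the sense of Hoffmann-Jorgensen: the limit is Borel
   measurable, the [Z n] are arbitrary maps. *)
Definition weakly_converges (R : realType) (E : topologicalType)
    (d : nat -> measure_display) (Omega : forall n, measurableType (d n))
    (Pr : forall n, probability (Omega n) R) (Z : forall n, Omega n -> E)
    d' (Omega' : measurableType d') (Pr' : probability Omega' R)
    (Zlim : Omega' -> E) : Prop :=
  (forall U : set E, open U -> measurable (Zlim @^-1` U)) /\
  forall h : E -> R, continuous h -> (exists M, forall z, `|h z| <= M) ->
    outer_expectation (Pr n) (h \o Z n) @[n --> \oo]
      --> (\int[Pr']_w (h (Zlim w))%:E)%E.

(** * Pseudometrics *)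

Definition absdist (R : realType) (x y : R) : \bar R := `|x - y|%:E.

Definition L2dist (R : realType) d (T : measurableType d)
    (P : probability T R) (g1 g2 : T -> R) : \bar R :=
  ('N[P]_2%:E[EFin \o (g1 \- g2)%R])%E.

Definition totally_bounded (R : realType) (T : Type) (dist : T -> T -> \bar R)
    (D : set T) : Prop :=
  forall eps : R, 0 < eps -> exists C : set T,
    [/\ finite_set C, C `<=` D &
        forall x, D x -> exists2 c, C c & (dist x c < eps%:E)%E].

Definition uniformly_continuous_on (R : realType) (S T : Type)
    (distS : S -> S -> \bar R) (distT : T -> T -> \bar R)
    (D : set S) (g : S -> T) : Prop :=
  forall eps : R, 0 < eps -> exists2 delta : R, 0 < delta &
    forall x y, D x -> D y ->
      (distS x y < delta%:E)%E -> (distT (g x) (g y) < eps%:E)%E.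

(** * Policies

    An observation is a triple [((x, a), y)] in [X * R * Y]; since a set of
    actions [A] need not be a pointed measurable type on its own, the
    observation space is a subset of this product. A policy is a real-valued
    map on [X]; limits in [L^2(P)] of [A]-valued policies need not be
    [A]-valued. *)

Section policies.
Context (R : realType) (dX dY : measure_display).
Context (X : measurableType dX) (Y : measurableType dY).

Definition obs_space (A : set R) : set (X * R * Y) := [set o | A o.1.2].

Definition on_obs (p : X -> R) (o : X * R * Y) : R := p o.1.1.

Context (P : probability (X * R * Y)%type R).

Definition policy_dist (p q : X -> R) : \bar R := L2dist P (on_obs p) (on_obs q).

(* Functions, rather than classes modulo [P]-almost sure equality. *)
Definition L2closure (Pi : set (X -> R)) : set (X -> R) :=
  [set p | on_obs p \in Lfun P 2%:E /\
           forall eps : R, 0 < eps ->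
             exists2 q, Pi q & (policy_dist p q < eps%:E)%E].

End policies.

Definition image_pt (S T : Type) (f : S -> T) (A : set S) (a : A) : f @` A :=
  SigSub (mem_set (imageP f (set_valP a))).

Definition regret (R : realType) (T : Type) (V : T -> R) (Pi : set T) (p : T)
  : R := sup [set V q | q in Pi] - V p.

(* Main.v *)
(** Outside an event of small outer probability, the linearization and the
    choice of [pihat] give, for every [q] in [Pi],
      [r (V q - V pihat) <= 3 eta + G (f pihat) - G (f q)].
    Since [G] is bounded in probability and [r] diverges, the regret of [pihat]
    tends to zero. Total boundedness of [Pi] then provides a [q] close to
    [pihat] with regret at most [eta / r] (no maximizer of [V] is needed), so
    asymptotic equicontinuity of [G], inherited from its weak limit, makes
    [G (f pihat) - G (f q)] small as well. *)

Require Import Defs.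
From HB Require Import structures.
From mathcomp Require Import all_boot all_order all_algebra.
From mathcomp Require Import all_classical all_reals all_analysis.
From mathcomp Require Import measurable_realfun ring lra.
Import Order.TTheory GRing.Theory Num.Theory.
Import numFieldNormedType.Exports.
Local Open Scope classical_set_scope.
Local Open Scope ring_scope.

Set Implicit Arguments.
Unset Strict Implicit.

(** * Limits in the extended reals, outer probability, continuity and measurability *)

Lemma cvge_near_lt (R : realType) (u : nat -> \bar R) (l e : \bar R) :
  u @ \oo --> l -> (l < e)%E -> \forall n \near \oo, (u n < e)%E.
Proof. by move=> ul le; apply: (ul [set y | (y < e)%E]); exact: open_ereal_lt'. Qed.

Lemma near_lt_cvg_to_0 (R : realType) (u : nat -> \bar R) :
  (forall n, 0 <= u n)%E ->
  (forall e : R, 0 < e -> \forall n \near \oo, (u n < e%:E)%E) ->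
  u @ \oo --> 0%E.
Proof.
move=> u_ge0 u_lt; apply/fine_cvgP; split.
  near=> n; rewrite ge0_fin_numE//.
  by rewrite (@lt_trans _ _ 1%:E) ?ltry//; near: n; exact: u_lt.
apply/cvgrPdist_lt => e e0; near=> n.
have un : (u n < e%:E)%E by near: n; exact: u_lt.
rewrite sub0r normrN ger0_norm ?fine_ge0//=.
by rewrite -lte_fin fineK// ge0_fin_numE// (lt_trans un) ?ltry.
Unshelve. all: by end_near. Qed.

(** Markov's inequality at level 1, applied to every integrable majorant [U] of [Z]: the set where
    [1 <= |U|] is measurable and contains [B], even if [B] itself is not measurable. *)
Lemma mu_ext_le_outer_expectation (R : realType) (d : measure_display)
    (T : measurableType d) (P : probability T R) (Z : T -> R) (B : set T) :
  (forall w, 0 <= Z w) -> (forall w, B w -> 1 <= Z w) ->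
  (mu_ext P B <= outer_expectation P Z)%E.
Proof.
move=> Z0 BZ; apply: le_ereal_inf_tmp => _ [U [intU ZU] <-].
have mU := measurable_int _ intU.
pose C := [set: T] `&` [set w | (1%:E <= `|U w|)%E].
have mC : measurable C.
  by apply: emeasurable_fun_c_infty => //; exact: measurableT_comp.
have BC : B `<=` C.
  move=> w Bw; split=> //=; rewrite (le_trans _ (lee_abs _))//.
  by rewrite (le_trans _ (ZU w))// lee_fin BZ.
rewrite (le_trans (le_mu_ext P BC))// measurable_mu_extE//.
rewrite (_ : (\int[P]_w U w = \int[P]_w `|U w|)%E); last first.
  apply: eq_integral => w _; rewrite gee0_abs// (le_trans _ (ZU w))//.
  by rewrite lee_fin.
rewrite -[leLHS]mul1e; exact: le_integral_abse.
Qed.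

(** Exchanging [x] and [y] turns the one-sided bound into a Lipschitz bound. The constant becomes
    [|C| + 1], which is a positive divisor whatever the sign of [C]. *)
Lemma one_sided_lipschitz_continuous (R : realType) (E : normedModType R)
    (h : E -> R) (C : R) :
  (forall x y, h x <= h y + C * `|x - y|) -> continuous h.
Proof.
move=> hC x; apply/cvgrPdist_lt => e e0.
have C0 : 0 < `|C| + 1 by rewrite ltr_wpDl.
have hC' y : `|h x - h y| <= (`|C| + 1) * `|x - y|.
  have CC : C * `|x - y| <= (`|C| + 1) * `|x - y|.
    by rewrite ler_wpM2r// (le_trans (ler_norm C))// lerDl.
  have h1 := hC x y; have := hC y x; rewrite distrC => h2.
  by rewrite ler_norml; apply/andP; split; lra.
near=> y; apply: le_lt_trans (hC' y) _.
rewrite mulrC -ltr_pdivlMr//; near: y.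
apply/nbhs_normP; exists (e / (`|C| + 1)) => //=; exact: divr_gt0.
Unshelve. all: by end_near. Qed.

Lemma measurable_fun_open_preimage (R : realType) (d : measure_display)
    (T : measurableType d) (g : T -> R) :
  (forall U : set R, open U -> measurable (g @^-1` U)) ->
  measurable_fun [set: T] g.
Proof.
move=> gU _; apply: (measurability _ (RGenOpens.measurableE R)) => //.
move=> _ [_ [a [b ->]] <-]; rewrite setTI; apply: gU.
exact: interval_open.
Qed.

(** * Tail bounds from weak convergence *)

Section weak_convergence.
Context (R : realType) (E : topologicalType) (d : nat -> measure_display).
Context (Omega : forall n, measurableType (d n)).
Context (Pr : forall n, probability (Omega n) R) (Z : forall n, Omega n -> E).
Context (d' : measure_display) (Omega' : measurableType d').
Context (Pr' : probability Omega' R) (Zlim : Omega' -> E).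
Hypothesis ZZlim : weakly_converges Pr Z Pr' Zlim.

Lemma weakly_converges_measurable (h : E -> R) :
  continuous h -> measurable_fun [set: Omega'] (h \o Zlim).
Proof.
move=> ch; apply: measurable_fun_open_preimage => U oU.
apply: (ZZlim.1 (h @^-1` U)).
by move/continuousP : ch; exact.
Qed.

(** By dominated convergence some [h k] has integral below [e] under the limit law. With this [k]
    fixed, weak convergence passes the bound to the outer expectations for large [n], and Markov's
    inequality concludes. *)
Lemma weakly_converges_near_mu_ext_lt (h : nat -> E -> R) (e : R) :
  (forall k, continuous (h k)) -> (forall k z, 0 <= h k z <= 1) ->
  {ae Pr', forall w, h k (Zlim w) @[k --> \oo] --> (0 : R)} ->
  0 < e ->
  exists k, \forall n \near \oo,
    (mu_ext (Pr n) [set w | 1 <= h k (@Z n w)]%R < e%:E)%E.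
Proof.
move=> ch h01 h0 e0.
have h_bnd k z : `|h k z| <= 1.
  by have /andP[? ?] := h01 k z; rewrite ger0_norm.
have : (\int[Pr']_w (h k (Zlim w))%:E)%E @[k --> \oo] --> 0%E.
  have [] := @dominated_convergence _ _ _ Pr' _ measurableT
    (fun k w => (h k (Zlim w))%:E) (cst 0%E) (cst 1%E).
  - move=> k; apply/measurable_EFinP.
    exact: weakly_converges_measurable.
  - exact: measurable_cst.
  - apply: filterS h0 => w hw _; apply/fine_cvgP; split; [exact: nearW|exact: hw].
  - exact: finite_measure_integrable_cst.
  - by apply/nearW => w k _; rewrite /= lee_fin.
  by rewrite integral0 => _ _.
move=> /cvge_near_lt-/(_ e%:E); rewrite lte_fin.
move=> /(_ e0)[k _ /(_ _ (leqnn k))/= hk].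
exists k.
have cvg_hk : outer_expectation (Pr n) (h k \o @Z n) @[n --> \oo] -->
    (\int[Pr']_w (h k (Zlim w))%:E)%E by apply: ZZlim.2 => //; exists 1.
have := cvge_near_lt cvg_hk hk.
apply: filterS => n; apply: le_lt_trans.
by apply: mu_ext_le_outer_expectation => w //=; have /andP[] := h01 k (Z w).
Qed.

End weak_convergence.

(** * The modulus of continuity on bounded functions *)

Section modulus.
Context (R : realType) (T : Type) (dist : T -> T -> \bar R).
Implicit Types (z : linfty T R) (delta c : R).

Definition modulus delta z : R :=
  sup [set `|z st.1 - z st.2| | st in [set st | (dist st.1 st.2 < delta%:E)%E]].

Lemma linfty_dist_le z s t : `|z s - z t| <= 2 * `|z|.
Proof.
rewrite (le_trans (ler_normB _ _))// mulr_natl mulr2n.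
by apply: lerD; exact: le_linfty_norm.
Qed.

Lemma le_modulus delta z s t :
  (dist s t < delta%:E)%E -> `|z s - z t| <= modulus delta z.
Proof.
move=> st; apply: ub_le_sup; last by exists (s, t).
by exists (2 * `|z|) => _ [? _ <-]; exact: linfty_dist_le.
Qed.

Lemma modulus_le delta z c : 0 <= c ->
  (forall s t, (dist s t < delta%:E)%E -> `|z s - z t| <= c) ->
  modulus delta z <= c.
Proof.
move=> c0 zc; rewrite /modulus; set S := (S in sup S).
(* No pair may be closer than [delta]; then [sup] takes its default value 0, which is why [0 <= c]
   is assumed. *)
have [->|/set0P ne] := eqVneq S set0; first by rewrite sup0.
by apply: ge_sup => // _ [[s t] /= st <-]; exact: zc.
Qed.

Lemma modulus_ge0 delta z : 0 <= modulus delta z.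
Proof.
rewrite /modulus; set S := (S in sup S).
have [->|/set0P[_ [[s t] st _]]] := eqVneq S set0; first by rewrite sup0.
by apply: le_trans (le_modulus _ st).
Qed.

Lemma modulus_lipschitz delta z z' :
  modulus delta z <= modulus delta z' + 2 * `|z - z'|.
Proof.
apply: modulus_le => [|s t st].
  by rewrite addr_ge0 ?modulus_ge0// mulr_ge0.
have zz' u : (z - z') u = z u - z' u :> R by [].
rewrite (_ : z s - z t = (z' s - z' t) + ((z - z') s - (z - z') t)); last first.
  by rewrite !zz'; ring.
by rewrite (le_trans (ler_normD _ _))// lerD ?linfty_dist_le// le_modulus.
Qed.

(* Truncating the sum of modulus and norm gives a single bounded test function
   for weak convergence that yields both equicontinuity and boundedness. *)
Definition modulus_test (eta : R) (k : nat) z : R :=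
  Num.min 1 (eta^-1 * modulus k.+1%:R^-1 z + k.+1%:R^-1 * `|z|).

Lemma modulus_test_continuous eta k : 0 < eta -> continuous (modulus_test eta k).
Proof.
move=> eta0; have k0 : 0 <= k.+1%:R^-1 :> R by rewrite invr_ge0.
apply: (@one_sided_lipschitz_continuous _ _ _ (eta^-1 * 2 + k.+1%:R^-1)).
move=> z z'; rewrite /modulus_test.
have h1 : eta^-1 * modulus k.+1%:R^-1 z
    <= eta^-1 * (modulus k.+1%:R^-1 z' + 2 * `|z - z'|).
  by rewrite ler_wpM2l ?modulus_lipschitz// invr_ge0 ltW.
have h2 : k.+1%:R^-1 * `|z| <= k.+1%:R^-1 * (`|z'| + `|z - z'|).
  by rewrite ler_wpM2l// -{1}(subrK z' z) addrC ler_normD.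
have h3 : 0 <= (eta^-1 * 2 + k.+1%:R^-1) * `|z - z'|.
  by rewrite mulr_ge0// addr_ge0// mulr_ge0// invr_ge0 ltW.
rewrite addr_minl le_min !ge_min; apply/andP; split; apply/orP.
  by left; rewrite lerDl.
right; rewrite mulrDl -mulrA addrACA; apply: lerD.
  by rewrite -mulrDr.
by rewrite -mulrDr.
Qed.

Lemma modulus_test_itv eta k z : 0 < eta -> 0 <= modulus_test eta k z <= 1.
Proof.
move=> eta0; rewrite /modulus_test ge_min lexx le_min ler01 andbT/=.
by rewrite addr_ge0// mulr_ge0 ?modulus_ge0 ?invr_ge0// ltW.
Qed.

Lemma modulus_test_lt1 eta k z : 0 < eta -> modulus_test eta k z < 1 ->
  modulus k.+1%:R^-1 z < eta /\ `|z| < k.+1%:R.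
Proof.
move=> eta0; rewrite /modulus_test gt_min ltxx/= => lt1.
have m0 : 0 <= eta^-1 * modulus k.+1%:R^-1 z.
  by rewrite mulr_ge0 ?modulus_ge0 ?invr_ge0// ltW.
have z0 : 0 <= k.+1%:R^-1 * `|z| by rewrite mulr_ge0 ?invr_ge0.
split; rewrite -[ltRHS]mulr1 -ltr_pdivrMl// (le_lt_trans _ lt1)//.
  by rewrite lerDl.
by rewrite lerDr.
Qed.

(** Uniform continuity makes the modulus vanish as its radius shrinks, while the fixed norm of [z]
    is killed by its weight. *)
Lemma modulus_test_cvg0 eta z : 0 < eta ->
  uniformly_continuous_on dist (@absdist R) [set: T] z ->
  modulus_test eta k z @[k --> \oo] --> (0 : R).
Proof.
move=> eta0 uz; apply/cvgrPdist_lt => e e0.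
(* The factor [eta] cancels the [eta^-1] of the test function. Each of the two summands gets
   [e / 3], which leaves room for a strict inequality. *)
have [delta delta0 zdelta] := uz _ (mulr_gt0 eta0 (divr_gt0 e0 (ltr0n R 3))).
have z1 : 0 < `|z| + 1 by rewrite ltr_wpDl.
near=> k.
have kdelta : k.+1%:R^-1 < delta.
  by near: k; exact: (near_infty_natSinv_lt (PosNum delta0)).
have ke : k.+1%:R^-1 < e / 3 / (`|z| + 1).
  near: k; have pos : 0 < e / 3 / (`|z| + 1) by rewrite !divr_gt0.
  exact: (near_infty_natSinv_lt (PosNum pos)).
rewrite sub0r normrN.
rewrite ger0_norm; last by have /andP[] := modulus_test_itv k z eta0.
rewrite /modulus_test gt_min; apply/orP; right.
have h1 : eta^-1 * modulus k.+1%:R^-1 z <= e / 3.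
  rewrite ler_pdivrMl//; apply: modulus_le => [|s t st].
    by rewrite mulr_ge0 ?ltW// divr_gt0.
  have := zdelta s t I I; rewrite /absdist !lte_fin => H; apply/ltW/H.
  by rewrite (lt_trans st)// lte_fin.
have h2 : k.+1%:R^-1 * `|z| <= e / 3.
  rewrite (@le_trans _ _ (k.+1%:R^-1 * (`|z| + 1)))//.
    by rewrite ler_wpM2l ?invr_ge0// lerDl.
  by rewrite -ler_pdivlMr// ltW.
by rewrite (le_lt_trans (lerD h1 h2))//; lra.
Unshelve. all: by end_near. Qed.

End modulus.

(** The truncated test functions vanish along almost every limit path, so outside a small event one
    of them is below 1 at [G n]. Its index [k] sets both the radius of the modulus and the bound on
    the norm. *)
Lemma weakly_converges_equicontinuous (R : realType) (T : Type)
    (dist : T -> T -> \bar R) (d : nat -> measure_display)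
    (Omega : forall n, measurableType (d n))
    (Pr : forall n, probability (Omega n) R)
    (G : forall n, Omega n -> linfty T R)
    (d' : measure_display) (Omega' : measurableType d')
    (Pr' : probability Omega' R) (Glim : Omega' -> linfty T R) (eta e : R) :
  weakly_converges Pr G Pr' Glim ->
  {ae Pr', forall w,
     uniformly_continuous_on dist (@absdist R) [set: T] (Glim w)} ->
  0 < eta -> 0 < e ->
  exists k : nat, \forall n \near \oo,
    (mu_ext (Pr n) (~` [set w | (modulus dist k.+1%:R^-1 (G n w) < eta)%R /\
                                (`|G n w| < k.+1%:R)%R]) < e%:E)%E.
Proof.
move=> GGlim uG eta0 e0.
have [k Gk] := weakly_converges_near_mu_ext_lt GGlim
  (fun k => @modulus_test_continuous _ _ dist _ k eta0)
  (fun k z => modulus_test_itv dist k z eta0)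
  (filterS (fun w => @modulus_test_cvg0 _ _ dist _ _ eta0) uG) e0.
exists k; apply: filterS Gk => n; apply: le_lt_trans; apply: le_mu_ext => w /=.
by apply: contra_notP => /negP; rewrite -ltNge; exact: modulus_test_lt1.
Qed.

(** * Consequences of total boundedness *)

(* Among the finitely many pieces of small diameter covering [D], those whose
   infimal regret is positive are avoided by points of small regret; every other
   piece contains points of arbitrarily small regret. *)
Lemma totally_bounded_near_maximizer (R : realType) (T : choiceType)
    (dist : T -> T -> \bar R) (D : set T) (rho : T -> R) (gamma : R) :
  (forall p q, D p -> D q -> dist p q = dist q p) ->
  (forall p q s, D p -> D q -> D s -> dist p s <= dist p q + dist q s)%E ->
  (forall p, D p -> 0 <= rho p) ->
  totally_bounded dist D -> 0 < gamma ->
  exists2 delta : R, 0 < delta & forall p, D p -> rho p <= delta ->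
    forall eta : R, 0 < eta ->
      exists q, [/\ D q, rho q <= eta & (dist q p < gamma%:E)%E].
Proof.
move=> sym tri rho0 tb gamma0.
(* With radius [gamma / 2], two points of the same piece are within [gamma] of each other. *)
have g2 : 0 < gamma / 2 by rewrite divr_gt0.
have [C [/finite_seqP[s Cs] CD Ccov]] := tb _ g2.
pose B c := [set p | D p /\ (dist p c < (gamma / 2)%:E)%E].
pose lowB c := forall eta : R, 0 < eta -> exists2 q, B c q & rho q <= eta.
have [delta delta0 Hdelta] : exists2 delta : R, 0 < delta &
    forall c, c \in s -> forall p, B c p -> rho p <= delta -> lowB c.
  elim: s {Cs} => [|c s [delta delta0 IH]]; first by exists 1.
  have [lc|/existsNP[eta /not_implyP[eta0 hc]]] := pselect (lowB c).
    by exists delta => // c'; rewrite inE => /predU1P[->//|]; exact: IH.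
  (* The failure of [lowB c] gives an [eta] such that every point of [B c] has regret above [eta]; a
     threshold below [eta] thus excludes this piece. *)
  exists (Num.min delta eta); first by rewrite lt_min delta0.
  move=> c'; rewrite inE => /predU1P[->|c's] p Bp; rewrite le_min => /andP[h1 h2].
    by exfalso; apply: hc; exists p.
  exact: IH Bp h1.
exists delta => // p Dp pdelta eta eta0.
have [c Cc pc] := Ccov p Dp.
have cs : c \in s by move: Cc; rewrite Cs.
have [q [Dq qc] qeta] := Hdelta c cs p (conj Dp pc) pdelta eta eta0.
exists q; split => //; rewrite (le_lt_trans (tri _ _ _ Dq (CD _ Cc) Dp))//.
by rewrite [gamma]splitr EFinD lteD// (sym c p (CD _ Cc) Dp).
Qed.

(** Every point lies near one of finitely many centres, where [V] differs by less than 1 from its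
    value at the centre. *)
Lemma totally_bounded_has_ubound (R : realType) (T : choiceType)
    (dist : T -> T -> \bar R) (D E : set T) (V : T -> R) :
  D `<=` E -> totally_bounded dist D ->
  uniformly_continuous_on dist (@absdist R) E V ->
  has_ubound [set V p | p in D].
Proof.
move=> DE tb uV; have [delta delta0 Vdelta] := uV 1 ltr01.
have [C [/finite_seqP[s Cs] CD Ccov]] := tb delta delta0.
have [M VM] : exists M, forall c, c \in s -> V c <= M.
  elim: s {Cs} => [|c s [M VM]]; first by exists 0.
  exists (Num.max (V c) M) => c'; rewrite inE => /predU1P[->|/VM VcM].
    by rewrite le_max lexx.
  by rewrite le_max VcM orbT.
exists (M + 1) => _ [p Dp <-]; have [c Cc pc] := Ccov p Dp.
have := Vdelta p c (DE _ Dp) (DE _ (CD _ Cc)) pc.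
rewrite /absdist lte_fin => /(le_lt_trans (ler_norm _)).
have cs : c \in s by move: Cc; rewrite Cs.
by have := VM c cs; lra.
Qed.

(** * The pseudometric of [L2(P)] and the closure of the policy class *)

Section L2dist.
Context (R : realType) (d : measure_display) (T : measurableType d).
Context (P : probability T R).
Implicit Types f g h : T -> R.

Lemma L2distC f g : L2dist P f g = L2dist P g f.
Proof.
rewrite /L2dist -oppe_Lnorm; apply: eq_Lnorm => t /=.
by rewrite opprB.
Qed.

Lemma L2distxx f : L2dist P f f = 0%E.
Proof.
rewrite /L2dist -(@Lnorm0 _ _ _ P 2%:E) ?eqe ?pnatr_eq0//.
by apply: eq_Lnorm => t /=; rewrite subrr.
Qed.

Lemma L2dist_triangle f g h :
  measurable_fun [set: T] f -> measurable_fun [set: T] g ->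
  measurable_fun [set: T] h ->
  (L2dist P f h <= L2dist P f g + L2dist P g h)%E.
Proof.
move=> mf mg mh; rewrite /L2dist (_ : f \- h = (f \- g) \+ (g \- h)).
  by apply: minkowski_EFin; rewrite ?ler1n//; exact: measurable_funB.
by apply/funext => t /=; ring.
Qed.

Lemma bounded_Lfun2 f (M : R) : measurable_fun [set: T] f ->
  (forall t, `|f t| <= M) -> f \in Lfun P 2%:E.
Proof.
move=> mf fM; apply/andP; split; rewrite inE//= /finite_norm unlock /=.
apply: poweR_lty; apply: (@le_lt_trans _ _ (\int[P]_t (M ^+ 2)%:E)%E).
  apply: ge0_le_integral => //.
  - apply/measurable_EFinP; apply: (measurableT_comp (measurable_powR 2)).
    exact: measurableT_comp.
  - move=> t _ /=; rewrite powR_mulrn// lee_fin.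
    by rewrite ler_sqr ?nnegrE// (le_trans _ (fM t)).
by rewrite integral_cst//= probability_setT mule1 ltry.
Qed.

End L2dist.

(** Makes uniform continuity on the closure available at the policies of [Pi]. *)
Lemma subset_L2closure (R : realType) (dX dY : measure_display)
    (X : measurableType dX) (Y : measurableType dY)
    (P : probability (X * R * Y)%type R) (Pi : set (X -> R)) (M : R) :
  (forall p, Pi p -> measurable_fun [set: X] p) ->
  (forall p, Pi p -> forall x, `|p x| <= M) -> Pi `<=` L2closure P Pi.
Proof.
move=> Pim PiM p Pip; split; last first.
  by move=> e e0; exists p => //; rewrite /policy_dist L2distxx lte_fin.
apply: bounded_Lfun2 => [|o]; last exact: PiM.
by apply: measurableT_comp; [exact: Pim|exact: measurableT_comp].
Qed.

(** * The rate of the regret *)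

Set Strict Implicit.
Unset Implicit Arguments.

Theorem theorem4 (R : realType) (dX dY : measure_display)
  (X : measurableType dX) (Y : measurableType dY)
  (A : set R) (hA : forall a, A a -> -1 <= a <= 1)
  (* the data (O_1, ..., O_n), with law nu n, on a sample space Omega n *)
  (nu : forall n : nat, probability (n.-tuple (X * R * Y)%type) R)
  (hnu : forall n, {ae nu n, forall s, forall i, obs_space A (tnth s i)})
  (dS : nat -> measure_display) (Omega : forall n, measurableType (dS n))
  (Pr : forall n, probability (Omega n) R)
  (data : forall n, {mfun Omega n >-> n.-tuple (X * R * Y)%type})
  (hdata : forall n B, measurable B -> Pr n (data n @^-1` B) = nu n B)
  (P : probability (X * R * Y)%type R)
  (hP : {ae P, forall o, obs_space A o})
  (Pi : set (X -> R))
  (hPiA : forall p, Pi p -> forall x, A (p x))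
  (hPim : forall p, Pi p -> measurable_fun [set: X] p)
  (V : (X -> R) -> R)
  (M : R) (f : (X -> R) -> X * R * Y -> R)
  (hfL2 : forall p, L2closure P Pi p -> f p \in Lfun P 2%:E)
  (hfM : forall p, L2closure P Pi p ->
     forall o, obs_space A o -> - M <= f p o <= M)
  (Vhat : forall n, n.-tuple (X * R * Y)%type -> Pi -> R)
  (r : forall n, Omega n -> R) (hr : diverges_in_probability Pr r)
  (G : forall n, Omega n -> linfty (f @` Pi) R)
  (* 1 *)
  (hPi_tb : totally_bounded (policy_dist P) Pi)
  (* 2 *)
  (hV : uniformly_continuous_on (policy_dist P) (@absdist R)
          (L2closure P Pi) V)
  (* 3 *)
  (hf : uniformly_continuous_on (policy_dist P) (L2dist P) (L2closure P Pi) f)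
  (* 4 *)
  (hlin : is_oP Pr
     (fun n w => ereal_sup
        [set `|r n w * (Vhat n (data n w) p - V (set_val p))
               - G n w (image_pt f p)|%:E | p in [set: Pi]])
     (fun _ _ => 1))
  (* 5 *)
  (dL : measure_display) (OmegaL : measurableType dL)
  (PrL : probability OmegaL R) (GP : OmegaL -> linfty (f @` Pi) R)
  (hweak : weakly_converges Pr G PrL GP)
  (hGP : {ae PrL, forall w, uniformly_continuous_on
            (fun g1 g2 : f @` Pi => L2dist P (set_val g1) (set_val g2))
            (@absdist R) [set: f @` Pi] (GP w)})
  (* 6 *)
  (pihat : forall n, n.-tuple (X * R * Y)%type -> Pi)
  (err : forall n, Omega n -> \bar R)
  (herr : is_oP Pr err (fun n w => (r n w)^-1))
  (hpihat : forall n w,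
     (ereal_sup [set (Vhat n (data n w) p)%:E | p in [set: Pi]] - err n w
       <= (Vhat n (data n w) (pihat n (data n w)))%:E)%E) :
  is_oP Pr (fun n w => (regret V Pi (set_val (pihat n (data n w))))%:E)
           (fun n w => (r n w)^-1).
Proof.
have PiL2 : Pi `<=` L2closure P Pi.
  apply: (@subset_L2closure _ _ _ _ _ _ _ 1) => // p Pip x.
  by rewrite ler_norml; exact/hA/hPiA.
have mobs p : Pi p -> measurable_fun [set: X * R * Y] (on_obs p).
  move=> Pip; apply: measurableT_comp; first exact: hPim.
  exact: measurableT_comp.
have Vub : has_ubound [set V p | p in Pi].
  exact: totally_bounded_has_ubound PiL2 hPi_tb hV.
pose rho := regret V Pi.
have rho_ge0 p : Pi p -> 0 <= rho p.
  by move=> Pip; rewrite subr_ge0; apply: ub_le_sup => //; exists p.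
(* The point [p0] witnesses that [Pi] is nonempty, so that the supremum is approached. *)
have near_max (p0 : Pi) e : 0 < e -> exists q : Pi, rho (set_val q) < e.
  move=> e0; have supV : has_sup [set V p | p in Pi].
    by split => //; exists (V (set_val p0)), (set_val p0) => //; exact: set_valP.
  have [_ [q Pq <-] Vq] := sup_adherent e0 supV.
  by exists (SigSub (mem_set Pq)); rewrite /rho /regret /=; lra.
(* The final bound has five terms [eta]: three from [basic], one from the regret of the comparison
   policy and one from equicontinuity. *)
move=> eps eps0; pose eta := eps / 5.
have eta0 : 0 < eta by rewrite divr_gt0.
apply: near_lt_cvg_to_0 => [n|e e0]; first exact: mu_ext_ge0.
(* One quarter for each of the bad events [B1] to [B4]. *)
have e4 : 0 < e / 4 by rewrite divr_gt0.
have [k Gk] := weakly_converges_equicontinuous hweak hGP eta0 e4.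
have k0 : 0 < k.+1%:R^-1 :> R by rewrite invr_gt0.
(* Policies within [gamma] have images under [f] within the radius at which the modulus of [G] is
   controlled. *)
have [gamma gamma0 fgamma] := hf _ k0.
have [delta delta0 Hdelta] := @totally_bounded_near_maximizer _ _
  (policy_dist P) Pi rho gamma (fun p q _ _ => L2distC P _ _)
  (fun p q s Pp Pq Ps => L2dist_triangle P (mobs p Pp) (mobs q Pq) (mobs s Ps))
  rho_ge0 hPi_tb gamma0.
(* Against an [eta / r]-maximizer, [basic] bounds [r] times the regret by [4 * eta] plus an
   oscillation of [G] of at most twice its norm. Hence [r > K] forces the regret below [delta]. *)
pose K := (4 * eta + 2 * k.+1%:R) / delta.
have K0 : 0 < K by rewrite divr_gt0// addr_gt0// mulr_gt0.
have e4E : (0 < (e / 4)%:E)%E by rewrite lte_fin.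
have [N _ HN] := filterI (filterI (cvge_near_lt (hr K) e4E)
    (cvge_near_lt (hlin eta eta0) e4E))
  (filterI (cvge_near_lt (herr eta eta0) e4E) Gk).
exists N => // n /HN [[mu1 mu2] [mu3 mu4]].
pose B1 := [set w | r n w <= K].
pose B2 := [set w | ((eta * `|1 : R|)%:E < `|ereal_sup
        [set `|r n w * (Vhat n (data n w) p - V (set_val p))
               - G n w (image_pt f p)|%:E | p in [set: Pi]]|)%E].
pose B3 := [set w | ((eta * `|(r n w)^-1|)%:E < `|err n w|)%E].
pose dF (g1 g2 : f @` Pi) := L2dist P (set_val g1) (set_val g2).
pose B4 := ~` [set w | (modulus dF k.+1%:R^-1 (G n w) < eta)%R /\
                       (`|G n w| < k.+1%:R)%R].
have mu_lt : (mu_ext (Pr n) (B1 `|` B2 `|` B3 `|` B4) < e%:E)%E.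
  rewrite (@le_lt_trans _ _ (mu_ext (Pr n) B1 + mu_ext (Pr n) B2 +
     mu_ext (Pr n) B3 + mu_ext (Pr n) B4)%E)//.
    do 3! (rewrite (le_trans (outer_measureU2 (mu_ext (Pr n)) _ _))// leeD//).
  rewrite (_ : e = e / 4 + e / 4 + e / 4 + e / 4); last by lra.
  rewrite !EFinD !lteD//.
apply: le_lt_trans mu_lt; apply: le_mu_ext => w /=; apply: contraPP.
rewrite !not_orP /B1 /B2 /B3 /B4 /=.
move=> -[[[/negP rw linw] errw] /contrapT [Gmod Gnorm]].
apply/negP; rewrite -leNgt.
rewrite -ltNge in rw.
set ph := pihat n (data n w).
have r0 : 0 < r n w by rewrite (lt_trans K0).
have Hl (p : Pi) : `|r n w * (Vhat n (data n w) p - V (set_val p))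
               - G n w (image_pt f p)| <= eta.
  rewrite -lee_fin; move/negP: linw; rewrite -leNgt normr1 mulr1.
  apply: le_trans; apply: le_trans (lee_abs _); apply: ereal_sup_ubound.
  by exists p.
have Hopt (q : Pi) : r n w * (Vhat n (data n w) q - Vhat n (data n w) ph) <= eta.
  have := hpihat n w; move/negP: errw; rewrite -leNgt.
  rewrite ger0_norm ?invr_ge0 ?(ltW r0)//.
  have : ((Vhat n (data n w) q)%:E <=
     ereal_sup [set (Vhat n (data n w) p)%:E | p in [set: Pi]])%E.
    by apply: ereal_sup_ubound; exists q.
  (* Infinite values of [err] contradict the bound [eta / r] on its absolute value. *)
  case: (err n w) => [x||]; rewrite ?leye_eq//= => Vq.
  rewrite lee_fin => xeta Vph.
  have : ((Vhat n (data n w) q)%:E - x%:E <= (Vhat n (data n w) ph)%:E)%E.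
    by apply: le_trans Vph; exact: leeD.
  rewrite -EFinB lee_fin => {}Vph.
  rewrite mulrC -ler_pdivlMr//.
  by have := ler_norm x; lra.
(* The linearization at [ph] and at [q] and the near-optimality of [ph] cost [eta] each; the
   supremum of [V] cancels between the two regrets. *)
have basic (q : Pi) : r n w * rho (set_val ph) <= 3 * eta +
    r n w * rho (set_val q) + (G n w (image_pt f ph) - G n w (image_pt f q)).
  have := Hl q; have := Hl ph; have := Hopt q.
  rewrite !ler_norml => h1 /andP[h2 h3] /andP[h4 h5].
  by rewrite /rho /regret; lra.
have etar : 0 < eta / r n w by rewrite divr_gt0.
have small : rho (set_val ph) <= delta.
  have [q] := near_max ph _ etar.
  rewrite ltr_pdivlMr// mulrC => qeta.
  have := basic q; have := linfty_dist_le (G n w) (image_pt f ph) (image_pt f q).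
  rewrite ler_norml => /andP[_ h1] h2.
  rewrite -(ler_pM2l r0) (@le_trans _ _ (K * delta))//.
    rewrite divfK ?gt_eqF//; lra.
  by rewrite ler_wpM2r// ltW.
(* The first comparison policy could be far from [ph]; the crude bound [small] now yields one that
   is close to [ph], so that the modulus of [G] applies. *)
have [q [Pq qeta qph]] := Hdelta _ (set_valP ph) small _ etar.
pose q' : Pi := SigSub (mem_set Pq).
have Gq : `|G n w (image_pt f ph) - G n w (image_pt f q')| < eta.
  rewrite distrC; apply: le_lt_trans Gmod; apply: le_modulus.
  by apply: fgamma => //; [exact: PiL2|exact/PiL2/set_valP].
rewrite lee_fin -/(rho _) ger0_norm; last exact/rho_ge0/set_valP.
rewrite ger0_norm ?invr_ge0 ?(ltW r0)// ler_pdivlMr// mulrC.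
rewrite ler_pdivlMr// mulrC in qeta.
have := basic q'; move: Gq; rewrite ltr_norml => /andP[_ h1] h2.
rewrite (_ : eps = 5 * eta); last by rewrite /eta; lra.
rewrite /= in h2; lra.
Qed.
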